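(* Every link diagram $D$ admits a twisting weight.
   Context: Link diagrams are unoriented diagrams in $\mathbb R^2$. For a link diagram $D$, $\mathcal X(D)$ is its finite set of crossings. A state on $D$ is a subset $S\subset\mathcal X(D)$. For a state $S$, $D_S\subset\mathbb R^2$ is the closed $1$-manifold obtained from $D$ by replacing each crossing $c$ by two disjoint arcs: the $0$-smoothing (Kauffman's $A$-smoothing) if $c\notin S$ and the $1$-smoothing ($B$-smoothing) if $c\in S$. $\pi_0(D_S)$ is the set of circles of $D_S$. A crossing $c$ is adjacent to a circle of $D_S$ if that circle contains at least one of the two arcs replacing $c$. If $c\notin S$, then $D_{S\cup\{c\}}$ is obtained from $D_S$ as follows: if $c$ is adjacent to a single circle of $D_S$, then $c$ splits that circle into two circles of $D_{S\cup\{c\}}$; if $c$ is adjacent to two circles of $D_S$, then $c$ merges them into one circle of $D_{S\cup\{c\}}$. The circles not adjacent to $c$ are unchanged and are identified with the corresponding circles of $D_{S\cup\{c\}}$. A twisting weight on $D$ is a map $\nu:\coprod_{S\subset\mathcal X(D)}\pi_0(D_S)\to\mathbb Z$ such that for every state $S$ and every $c\in\mathcal X(D)\setminus S$: (a) if $C\in\pi_0(D_S)$ splits into $C_1',C_2'\in\pi_0(D_{S\cup\{c\}})$, then $\nu(C)=\nu(C_1')+\nu(C_2')-1$; (b) if $C_1,C_2\in\pi_0(D_S)$ merge into $C'\in\pi_0(D_{S\cup\{c\}})$, then $\nu(C_1)+\nu(C_2)=\nu(C')$; (c) if $C\in\pi_0(D_S)$ is identified with $C'\in\pi_0(D_{S\cup\{c\}})$,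 then $\nu(C)=\nu(C')$. *)

(* Defs.v *)
From HB Require Import structures.
From mathcomp Require Import all_boot all_order all_algebra.

Set Implicit Arguments.
Unset Strict Implicit.
Unset Printing Implicit Defensive.

(* A link diagram in the plane is encoded as a plane 4-valent map with
   over/under information (a planar diagram code), together with its components
   without crossings.  Each crossing c carries the half-edges (c, 0), (c, 1),
   (c, 2), (c, 3), listed counterclockwise, where (c, 0) and (c, 2) belong to
   the under-strand and (c, 1) and (c, 3) to the over-strand. *)
Definition half_edge (X : finType) : finType := (X * 'I_4)%type.

Section Planarity.
Variables (X : finType) (opp : half_edge X -> half_edge X).

(* Travel along the edge of h, then turn to its counterclockwise successor:
   the orbits are the boundary walks of the faces. *)
Definition face_step (h : half_edge X) : half_edge X :=
  let: (c, k) := opp h in (c, ordS k).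

Definition linked : rel (half_edge X) :=
  [rel h h' | (h' == opp h) || (h'.1 == h.1)].

(* Euler's formula V - E + F = 2 K.  The boundary walks are counted separately
   on each of the K connected components, hence 2 K and not 1 + K: every
   component is drawn on its own sphere. *)
Definition genus0 : bool :=
  #|X| + fcard face_step predT == fcard opp predT + (n_comp linked predT).*2.

End Planarity.

(* [opp] exchanges the two half-edges of an edge.  The relative position in the
   plane of the connected components is not recorded: smoothings, circles and
   adjacency do not depend on it. *)
Record link_diagram := LinkDiagram {
  crossing : finType;
  opp : half_edge crossing -> half_edge crossing;
  opp_involutive : involutive opp;
  opp_neq : forall h, opp h != h;
  opp_genus0 : genus0 opp;
  free_circle : finType
}.

Section States.
Variable D : link_diagram.

Definition state := {set crossing D}.

(* The other end of the arc through the half-edge h in the smoothing of its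
   crossing.  The A-smoothing joins the two regions swept by the over-strand
   turning counterclockwise, which lie between 1 and 2 and between 3 and 0; its
   arcs are therefore {0, 1} and {2, 3}, and those of the B-smoothing are
   {1, 2} and {3, 0}. *)
Definition smooth (S : state) (h : half_edge (crossing D)) :
    half_edge (crossing D) :=
  let: (c, k) := h in
  (c, if odd k == (c \in S) then ordS k else ord_pred k).

Definition piece : finType :=
  (half_edge (crossing D) + free_circle D)%type.

Definition joined (S : state) : rel piece := fun x y =>
  match x, y with
  | inl h, inl h' => (h' == opp h) || (h' == smooth S h)
  | _, _ => false
  end.

(* A circle of D_S is represented by the set of pieces that it contains. *)
Definition pi0 (S : state) : {set {set piece}} :=
  equivalence_partition (connect (joined S)) [set: piece].

Definition circle (S : state) : finType := {C : {set piece} | C \in pi0 S}.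

Definition adjacent (S : state) (c : crossing D) (C : circle S) : Prop :=
  exists k : 'I_4, inl (c, k) \in val C.

Definition splits (S : state) (c : crossing D)
    (C : circle S) (C1' C2' : circle (c |: S)) : Prop :=
  [/\ forall B : circle S, adjacent c B <-> B = C,
      C1' <> C2' &
      forall B' : circle (c |: S), adjacent c B' <-> B' = C1' \/ B' = C2'].

Definition merges (S : state) (c : crossing D)
    (C1 C2 : circle S) (C' : circle (c |: S)) : Prop :=
  [/\ C1 <> C2,
      forall B : circle S, adjacent c B <-> B = C1 \/ B = C2 &
      forall B' : circle (c |: S), adjacent c B' <-> B' = C'].

Definition identified (S : state) (c : crossing D)
    (C : circle S) (C' : circle (c |: S)) : Prop :=
  ~ adjacent c C /\ val C = val C'.

Definition twisting_weight (nu : forall S : state, circle S -> int) : Prop :=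
  forall (S : state) (c : crossing D), c \notin S ->
  [/\ forall (C : circle S) (C1' C2' : circle (c |: S)),
        splits C C1' C2' -> nu S C = (nu (c |: S) C1' + nu (c |: S) C2' - 1)%R,
      forall (C1 C2 : circle S) (C' : circle (c |: S)),
        merges C1 C2 C' -> (nu S C1 + nu S C2)%R = nu (c |: S) C' &
      forall (C : circle S) (C' : circle (c |: S)),
        identified C C' -> nu S C = nu (c |: S) C'].

End States.

(* Main.v *)
Require Import Defs.
From mathcomp Require Import all_boot all_order all_algebra.
From HB Require Import structures.
From mathcomp Require Import zify.

(* Colour the faces of D like a checkerboard and orient every circle C of every
   D_S so that the faces of one colour lie on its left: both smoothings of a
   crossing respect this orientation of the edges.  Since the diagram is planar,
   C is the jump set of an integer function p_C on the faces, unique once it is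
   normalised on one face of each component.  Let q(C) be the value of p_C along
   the left side of C.  When two circles A and B merge into M, or M splits into A
   and B, one has p_M = p_A + p_B, and reading it at the crossing gives
   q(M) = q(A) + q(B) - e, where e = 1 if the arcs of A and B at the crossing
   cut off its left-coloured corners and e = 0 otherwise.  This is the twisting
   rule at the crossings whose B-smoothing cuts off these corners; at the other
   crossings it is restored by adding 1 to the circle through one chosen end of
   the crossing, as soon as the crossing is B-smoothed.  The existence of p_C is
   the vanishing of the first homology, obtained from Euler's formula by
   counting dimensions. *)

Set Implicit Arguments.
Unset Strict Implicit.
Unset Printing Implicit Defensive.

Import Num.Theory GRing.Theory.
Local Open Scope ring_scope.

(** * Linear algebra of functions on a finite set *)

Section FunctionSpaces.
Variables (F : fieldType) (T : finType).
Local Notation V := {ffun T -> F^o}.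
Implicit Types (u : V) (U : {vspace V}) (f : T -> T) (R : {pred T}).

(* The kernel consists of the f-invariant functions for a = -1, and of those
   changing sign along f for a = 1; for a = 0 this is composition with f. *)
Definition pull_fun f (a : F) u : V := [ffun x => u (f x) + a * u x].

Lemma pull_fun_linear f a : linear (pull_fun f a).
Proof.
move=> k u v; apply/ffunP=> x; rewrite !ffunE /= /GRing.scale /=.
by rewrite !mulrDr -!addrA; congr (_ + _); rewrite addrCA mulrCA.
Qed.

HB.instance Definition _ f a :=
  GRing.isLinear.Build F V V _ (pull_fun f a) (pull_fun_linear f a).

Definition pull f a : 'End(V) := linfun (pull_fun f a).

Lemma pullE f a u x : pull f a u x = u (f x) + a * u x.
Proof. by rewrite lfunE ffunE. Qed.

Definition restrict_fun R u : V := [ffun x => if x \in R then u x else 0].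

Lemma restrict_fun_linear R : linear (restrict_fun R).
Proof.
by move=> k u v; apply/ffunP=> x; rewrite !ffunE; case: ifP; rewrite ?scaler0 ?addr0.
Qed.

HB.instance Definition _ R :=
  GRing.isLinear.Build F V V _ (restrict_fun R) (restrict_fun_linear R).

Definition delta x : V := [ffun y => (x == y)%:R].

Lemma ffun_sum_delta u : u = \sum_x u x *: delta x.
Proof.
apply/ffunP=> x; rewrite sum_ffunE (bigD1 x) //= big1 ?addr0 => [|y /negPf yx].
  by rewrite !ffunE eqxx [_ *: _]mulr1.
by rewrite !ffunE yx [_ *: _]mulr0.
Qed.

Lemma dim_ffunv : \dim {:V} = #|T|.
Proof. by rewrite dimvf /dim /= muln1. Qed.

(** Restriction to [R] is injective on [U], and its image lies in the span of the [delta x] for [x]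
    in [R]. *)
Lemma dim_le_determined U R :
    (forall u, u \in U -> {in R, forall x, u x = 0} -> u = 0) ->
  (\dim U <= #|R|)%N.
Proof.
move=> U_det; have UK0 : (U :&: lker (linfun (restrict_fun R)) = 0)%VS.
  apply/eqP; rewrite -subv0; apply/subvP=> u /memv_capP[Uu].
  rewrite memv_ker lfunE memv0 => /eqP u0; apply/eqP/U_det => // x Rx.
  by have /ffunP/(_ x) := u0; rewrite !ffunE Rx.
rewrite -(limg_dim_eq UK0) cardE -(size_map delta).
apply: leq_trans (dim_span _); apply: dimvS.
apply/subvP=> _ /memv_imgP[u _ ->]; rewrite lfunE /= [restrict_fun _ _]ffun_sum_delta.
apply: memv_suml => x _; rewrite ffunE; case: ifP => [Rx | _].
  by apply/memvZ/memv_span/map_f; rewrite mem_enum.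
by rewrite scale0r mem0v.
Qed.

(* Functions constant on connected components are determined by their values
   on the chosen roots, and conversely these values are arbitrary. *)
Lemma dim_invariant_ge (e : rel T) U : connect_sym e ->
    (forall u, (forall x y, e x y -> u x = u y) -> u \in U) ->
  (n_comp e predT <= \dim U)%N.
Proof.
move=> e_sym invU; pose G := pull (fingraph.root e) 0.
have imG : (limg G <= U)%VS.
  apply/subvP=> _ /memv_imgP[u _ ->]; apply: invU => x y exy.
  by rewrite !pullE !mul0r (fingraph.rootP e_sym (connect1 exy)).
apply: leq_trans (dimvS imG); have := limg_ker_dim G fullv.
rewrite capfv dim_ffunv => dimG.
(* A function in the kernel vanishes at the roots, so its values elsewhere determine it. *)
have: (\dim (lker G) <= #|[predC roots e]|)%N.
  apply: dim_le_determined => u; rewrite memv_ker => /eqP uG u0.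
  apply/ffunP=> x; rewrite ffunE;
  case: (boolP (roots e x)) => [/eqP rx|]; last exact: u0.
  by have /ffunP/(_ x) := uG; rewrite pullE rx mul0r addr0 ffunE.
rewrite -(leq_add2r (\dim (limg G))) dimG -(cardC (roots e)) addnC leq_add2l.
apply: leq_trans; apply: subset_leq_card.
by apply/subsetP=> x; rewrite inE => /andP[].
Qed.

End FunctionSpaces.

(** * Quarter turns around a crossing *)

Section Rotation.
Variable X : finType.
Implicit Types h : half_edge X.

Definition turn h : half_edge X := (h.1, ordS h.2).

Lemma turn4 h : turn (turn (turn (turn h))) = h.
Proof. by case: h => c [[|[|[|[|k]]]] lk] //; congr (_, _); apply: val_inj. Qed.

Lemma turn_inj : injective turn.
Proof. by apply: can_inj (fun h => turn (turn (turn h))) _ => h; apply: turn4. Qed.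

Lemma turn_invariant (A : Type) (u : half_edge X -> A) h h' :
  (forall h, u (turn h) = u h) -> h.1 = h'.1 -> u h = u h'.
Proof.
move=> u_turn; have u0 c k : u (c, k) = u (c, ord0).
  case: k => [[|[|[|[|k]]]] lk] //.
  - by congr (u (_, _)); apply: val_inj.
  - by rewrite -[RHS]u_turn; congr (u (_, _)); apply: val_inj.
  - by do 2!rewrite -[RHS]u_turn; congr (u (_, _)); apply: val_inj.
  - by do 3!rewrite -[RHS]u_turn; congr (u (_, _)); apply: val_inj.
by case: h h' => [c k] [c' k'] /= ->; rewrite u0 [RHS]u0.
Qed.

End Rotation.

(** * Vanishing of the first homology of a plane map *)

Section Homology.
Variables (X : finType) (opp : half_edge X -> half_edge X).
Hypothesis oppK : involutive opp.
Hypothesis planar : genus0 opp.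
Implicit Types h : half_edge X.

Lemma face_stepE h : face_step opp h = turn (opp h).
Proof. by rewrite /face_step; case: (opp h). Qed.

Lemma face_step_inj : injective (face_step opp).
Proof. by move=> h h'; rewrite !face_stepE => /turn_inj/(inv_inj oppK). Qed.

Lemma linked_sym : connect_sym (linked opp).
Proof.
apply: sym_connect_sym => h h'; rewrite /linked /= [h'.1 == _]eq_sym; congr (_ || _).
by apply/eqP/eqP=> ->; rewrite oppK.
Qed.

(** As [face_step] is [opp] followed by [turn], such a function is also invariant under [opp], hence
    constant on each connected component. *)
Lemma linked_invariant (A : Type) (u : half_edge X -> A) :
    (forall h, u (turn h) = u h) -> (forall h, u (face_step opp h) = u h) ->
  forall h, u (fingraph.root (linked opp) h) = u h.
Proof.
move=> u_turn u_face h; have u_opp h1 : u (opp h1) = u h1.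
  by rewrite -u_turn -face_stepE u_face.
have /connectP[p + ->] := connect_root (linked opp) h.
elim: p h => //= h1 p IHp h /andP[/orP[/eqP-> | /eqP e1] hp].
  by rewrite IHp.
rewrite IHp //; exact: turn_invariant.
Qed.

Section Field.
Variable F : fieldType.
Local Notation V := {ffun half_edge X -> F^o}.

(** Up to sign, the boundary map on 1-chains, which are encoded as functions antisymmetric under
    [opp]. *)
Definition vertex_sum_fun (u : V) : {ffun X -> F^o} :=
  [ffun c => \sum_(k < 4) u (c, k)].

Lemma vertex_sum_fun_linear : linear vertex_sum_fun.
Proof.
move=> k u v; apply/ffunP=> c; rewrite !ffunE scaler_sumr -big_split.
by apply: eq_bigr => i _; rewrite !ffunE.
Qed.

HB.instance Definition _ := GRing.isLinear.Build F V {ffun X -> F^o} _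
  vertex_sum_fun vertex_sum_fun_linear.

Definition vertex_sum : 'Hom(V, {ffun X -> F^o}) := linfun vertex_sum_fun.

Lemma vertex_sumE u c : vertex_sum u c = \sum_(k < 4) u (c, k).
Proof. by rewrite lfunE ffunE. Qed.

Let A := lker (pull opp (1 : F)).

Lemma antisymP (u : V) : reflect (forall h, u (opp h) = - u h) (u \in A).
Proof.
rewrite memv_ker; apply: (iffP eqP) => [/ffunP u0 h | uN].
  by have := u0 h; rewrite pullE ffunE mul1r => /eqP; rewrite addr_eq0 => /eqP.
by apply/ffunP=> h; rewrite pullE uN mul1r addNr ffunE.
Qed.

Lemma invariantP f (u : V) :
  reflect (forall h, u (f h) = u h) (u \in lker (pull f (-1 : F))).
Proof.
rewrite memv_ker; apply: (iffP eqP) => [/ffunP u0 h | uN].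
  by have /eqP := u0 h; rewrite pullE ffunE mulN1r subr_eq0 => /eqP.
by apply/ffunP=> h; rewrite pullE uN mulN1r subrr ffunE.
Qed.

Lemma dim_antisym : (\dim A <= fcard opp predT)%N.
Proof.
have fsym := fconnect_sym (inv_inj oppK).
apply: (@leq_trans #|roots (frel opp)|); last first.
  by apply/subset_leq_card/subsetP=> h rh; rewrite !inE; apply/andP.
apply: dim_le_determined => u /antisymP uN u0; apply/ffunP=> h; rewrite ffunE.
have cl : fclosed opp [pred h | u h == 0].
  by apply: intro_closed => // x _ /eqP<-; rewrite !inE uN oppr_eq0.
apply/eqP; have := closed_connect cl (connect_root (frel opp) h).
by rewrite !inE => ->; apply/eqP/u0/roots_root.
Qed.

Lemma vertex_sum_delta h : vertex_sum (delta F h) = delta F h.1.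
Proof.
apply/ffunP=> c; rewrite vertex_sumE ffunE; case: h => d j /=.
under eq_bigr do rewrite ffunE xpair_eqE.
rewrite (bigD1 j) //= eqxx andbT big1 ?addr0 // => k.
by rewrite eq_sym => /negPf->; rewrite andbF.
Qed.

(** Crossing an edge changes [delta] of a vertex by a boundary, so modulo boundaries one vertex in
    each component is enough. *)
Lemma dim_vertex_sum :
  (#|X| <= n_comp (linked opp) predT + \dim (vertex_sum @: A))%N.
Proof.
pose r := roots (linked opp).
pose E := <<[seq delta F h.1 | h <- enum r]>>%VS.
have fullE : (fullv <= E + vertex_sum @: A)%VS.
  apply/subvP=> v _; rewrite [v]ffun_sum_delta; apply: memv_suml => c _.
  apply: memvZ; pose inW c := delta F c \in (E + vertex_sum @: A)%VS.
  rewrite -/(inW (c, ord0 : 'I_4).1).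
  have cl : closed (linked opp) [pred h : half_edge X | inW h.1].
    apply: (intro_closed linked_sym) => x y /orP[/eqP-> | /eqP xy]; rewrite !inE /inW.
      have -> : delta F (opp x).1 = delta F x.1 + vertex_sum (delta F (opp x) - delta F x).
        by rewrite linearB /= !vertex_sum_delta addrC subrK.
      move=> inWx; apply: rpredD => //; apply/(subvP (addvSr _ _))/memv_img.
      apply/antisymP=> h; rewrite !ffunE (inj_eq (inv_inj oppK)) opprB.
      by rewrite (can2_eq oppK oppK).
    by rewrite xy.
  have := closed_connect cl (connect_root (linked opp) (c, ord0)).
  rewrite !inE => ->; rewrite /inW -[delta _ _]addr0 memv_add ?mem0v //.
  by apply/memv_span/mapP; eexists; rewrite ?mem_enum //; exact: (roots_root linked_sym).
rewrite -(dim_ffunv F X); apply: leq_trans (dimvS fullE) _.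
apply: leq_trans (leq_of_leqif (dimv_add_leqif _ _)) _; rewrite leq_add2r.
apply: leq_trans (dim_span _) _; rewrite size_map -cardE.
by apply/subset_leq_card/subsetP=> h rh; rewrite !inE; apply/andP.
Qed.


(** Jumps of face functions are cycles. They span dimension at least F - K, the cycles have
    dimension at most E - V + K, and Euler's formula makes these two bounds equal. *)
Lemma potential_field (alpha : V) :
    (forall h, alpha (opp h) = - alpha h) ->
    (forall c, \sum_(k < 4) alpha (c, k) = 0) ->
  exists p : V, (forall h, p (face_step opp h) = p h) /\
                (forall h, p (turn h) = p h + alpha h).
Proof.
move=> alphaN alpha0; pose Phi := lker (pull (face_step opp) (-1 : F)).
pose d := pull (@turn X) (-1 : F).
suff: alpha \in (d @: Phi)%VS.
  case/memv_imgP=> p /invariantP p_face ->; exists p; split=> // h.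
  by rewrite pullE mulN1r addrC subrK.
suff /eqP-> : (d @: Phi == A :&: lker vertex_sum)%VS.
  rewrite memv_cap memv_ker; apply/andP; split; first exact/antisymP.
  by apply/eqP/ffunP=> c; rewrite vertex_sumE ffunE.
rewrite eqEdim; apply/andP; split.
  apply/subvP=> _ /memv_imgP[p /invariantP p_face ->]; rewrite memv_cap.
  have p_turn h : p (turn h) = p (opp h) by rewrite -(p_face (opp h)) face_stepE oppK.
  apply/andP; split.
    by apply/antisymP=> h; rewrite !pullE !p_turn oppK !mulN1r opprB.
  rewrite memv_ker; apply/eqP/ffunP=> c; rewrite vertex_sumE ffunE.
  under eq_bigr do rewrite pullE mulN1r.
  rewrite sumrB [X in _ - X](reindex_inj (h := @ordS 4)) /=; last exact: ordS_inj.
  by rewrite subrr.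
have dimK : (\dim (Phi :&: lker d) <= n_comp (linked opp) predT)%N.
  apply: (@leq_trans #|roots (linked opp)|); last first.
    by apply/subset_leq_card/subsetP=> h rh; rewrite !inE; apply/andP.
  apply: dim_le_determined => u /memv_capP[/invariantP u_face /invariantP u_turn] u0.
  apply/ffunP=> h; rewrite ffunE -linked_invariant //.
  exact/u0/roots_root/linked_sym.
have dimPhi : (fcard (face_step opp) predT <= \dim Phi)%N.
  apply: dim_invariant_ge => [|u u_face]; first exact/fconnect_sym/face_step_inj.
  by apply/invariantP=> h; rewrite -(u_face h (face_step opp h)) //=.
move: dimK dimPhi dim_antisym dim_vertex_sum (eqP planar).
rewrite -(limg_ker_dim d Phi) -(limg_ker_dim vertex_sum A) -addnn.
lia.
Qed.

End Field.

Lemma root_turn h :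
  fingraph.root (linked opp) (turn h) = fingraph.root (linked opp) h.
Proof.
apply/eqP; rewrite (root_connect linked_sym) connect1 //.
by rewrite /linked /= eqxx orbT.
Qed.

Lemma root_face h :
  fingraph.root (linked opp) (face_step opp h) = fingraph.root (linked opp) h.
Proof.
rewrite face_stepE root_turn; apply/eqP.
by rewrite (root_connect linked_sym) connect1 // /linked /= oppK eqxx.
Qed.

(** Over the field with two elements, the constant 1 is a cycle because all valencies are 4; its
    potential is the colouring. *)
Lemma checkerboard : exists b : half_edge X -> bool,
  (forall h, b (face_step opp h) = b h) /\ (forall h, b (turn h) = ~~ b h).
Proof.
have [||p [p_face p_turn]] :=
    @potential_field 'F_2 [ffun=> 1 : ('F_2)^o].
- by move=> h; rewrite !ffunE; apply: val_inj.
- move=> c; under eq_bigr do rewrite ffunE.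
  by rewrite !big_ord_recl big_ord0; apply: val_inj.
exists (fun h => p h == 1 :> 'F_2); split=> h; first by rewrite p_face.
by rewrite p_turn ffunE; case: (p h : 'F_2) => [[|[|m]]] lm.
Qed.

(* A half-edge h stands for the face on its right as one leaves the crossing, so
   that turn h stands for the face on its left. *)
Definition is_potential (alpha p : half_edge X -> int) :=
  [/\ forall h, p (face_step opp h) = p h,
      forall h, p (turn h) = p h + alpha h &
      forall h, p (fingraph.root (linked opp) h) = 0].

Lemma potential_exists (alpha : half_edge X -> int) :
    (forall h, alpha (opp h) = - alpha h) ->
    (forall c, \sum_(k < 4) alpha (c, k) = 0) ->
  exists p, is_potential alpha p.
Proof.
move=> alphaN alpha0.
have [||q [q_face q_turn]] :=
    @potential_field rat [ffun h => (alpha h)%:~R : rat^o].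
- by move=> h; rewrite !ffunE alphaN rmorphN.
- move=> c; under eq_bigr do rewrite ffunE.
  by rewrite -[RHS](rmorph0 intr) -(alpha0 c) rmorph_sum.
pose d h : rat := q h - q (fingraph.root (linked opp) h).
have d_face h : d (face_step opp h) = d h by rewrite /d root_face q_face.
have d_turn h : d (turn h) = d h + (alpha h)%:~R.
  by rewrite /d root_turn q_turn ffunE addrAC.
have d_root h : d (fingraph.root (linked opp) h) = 0.
  by rewrite /d (root_root linked_sym) subrr.
(* [d] vanishes at the roots and has integer jumps, so integrality spreads over each component. *)
have d_int h : d h \is a Num.int.
  rewrite -(@linked_invariant _ (fun h => d h \is a Num.int)) ?d_root ?rpred0 //.
    by move=> h1; rewrite d_turn rpredDr // intr_int.
  by move=> h1; rewrite d_face.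
exists (fun h => Num.floor (d h)); split=> h; first by rewrite d_face.
  by rewrite d_turn -{1}(floorK (d_int h)) -rmorphD /= intrKfloor.
by rewrite d_root floor0.
Qed.

Lemma potential_unique alpha p p' :
  is_potential alpha p -> is_potential alpha p' -> p =1 p'.
Proof.
case=> p_face p_turn p0 [p'_face p'_turn p'0] h; apply/eqP; rewrite -subr_eq0.
rewrite -(@linked_invariant _ (fun h => p h - p' h)) => [|h1|h1].
- by rewrite p0 p'0.
- by rewrite p_turn p'_turn opprD addrACA subrr addr0.
- by rewrite p_face p'_face.
Qed.

End Homology.

(** * Circles of two states that differ at one crossing *)

Section Circles.
Variable D : link_diagram.
Local Notation H := (half_edge (crossing D)).
Implicit Types (S R : state D) (c : crossing D) (h : H) (x y : piece D).
Implicit Types (A B C : {set piece D}).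

Lemma odd_turn h : odd (turn h).2 = ~~ odd h.2.
Proof. by case: h => c [[|[|[|[|k]]]] lk]. Qed.

Lemma smoothE S h :
  smooth S h = if odd h.2 == (h.1 \in S) then turn h else turn (turn (turn h)).
Proof.
case: h => c k; rewrite /smooth /=; case: ifP => // _.
by case: k => [[|[|[|[|k]]]] lk] //; congr (_, _); apply: val_inj.
Qed.

Lemma smoothK S : involutive (smooth S).
Proof.
move=> h; rewrite (smoothE S h); case: ifP; rewrite smoothE !odd_turn /=;
  by case: (odd _) (_ \in S) => [] [] //= _; rewrite turn4.
Qed.

Lemma joined_sym S : connect_sym (joined S).
Proof.
apply: sym_connect_sym => -[h | f] [h' | f'] //=.
by rewrite !(eq_sym h') (can2_eq (@opp_involutive D) (@opp_involutive D))
  (can2_eq (smoothK S) (smoothK S)).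
Qed.

Lemma circle_of S x : [set y | connect (joined S) x y] \in pi0 S.
Proof.
by apply/imsetP; exists x => //; apply/setP=> y; rewrite !inE.
Qed.

Lemma circleE S C x : C \in pi0 S -> x \in C ->
  C = [set y | connect (joined S) x y].
Proof.
case/imsetP=> z _ -> {C}; rewrite !inE => /= zx.
by apply/setP=> y; rewrite !inE /= (same_connect (joined_sym S) zx).
Qed.

Lemma circle_inj S A B x : A \in pi0 S -> B \in pi0 S ->
  x \in A -> x \in B -> A = B.
Proof. by move=> SA SB xA xB; rewrite (circleE SA xA) (circleE SB xB). Qed.

Lemma circle_closed S C x y : C \in pi0 S -> joined S x y ->
  (x \in C) = (y \in C).
Proof.
move=> SC xy; apply/idP/idP => [xC|yC].
  by rewrite (circleE SC xC) inE connect1.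
by rewrite (circleE SC yC) inE joined_sym connect1.
Qed.

Lemma circle_opp S C h : C \in pi0 S -> (inl (Defs.opp h) \in C) = (inl h \in C).
Proof. by move=> SC; apply/esym/(circle_closed SC); rewrite /= eqxx. Qed.

Lemma circle_smooth S C h :
  C \in pi0 S -> (inl (smooth S h) \in C) = (inl h \in C).
Proof. by move=> SC; apply/esym/(circle_closed SC); rewrite /= eqxx orbT. Qed.

Definition meets c C := [exists k : 'I_4, inl (c, k) \in C].

Lemma adjacentP S c (C : circle S) : reflect (adjacent c C) (meets c (val C)).
Proof. exact: existsP. Qed.

(** Symmetric in the two states, so that a splitting can be treated as a merging read backwards. *)
Definition agree_off c S R := forall d, d != c -> (d \in S) = (d \in R).

Lemma pi0_unmet c S R C : agree_off c S R -> C \in pi0 S -> ~~ meets c C ->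
  C \in pi0 R.
Proof.
move=> SR SC cC; have [x xC]: exists x, x \in C.
  by case/imsetP: SC => x _ ->; exists x; rewrite !inE /= connect0.
have joinedSR y z : y \in C -> joined S y z = joined R y z.
  case: y z => [[d k]|?] [h'|?] //= yC; have /SR SRd: d != c.
    by apply: contra cC => /eqP <-; apply/existsP; exists k.
  by rewrite SRd.
suff -> : C = [set y | connect (joined R) x y] by apply: circle_of.
have RC : closed (joined R) C.
  apply: (intro_closed (joined_sym R)) => y z yz yC.
  by rewrite -(circle_closed SC (x := y)) ?joinedSR.
have sub y : connect (joined R) x y -> y \in C.
  by move=> /(closed_connect RC) <-.
apply/setP=> y; rewrite inE; apply/idP/idP => [yC|]; last exact: sub.
have cl : closed (joined S) [pred y | connect (joined R) x y].
  apply: (intro_closed (joined_sym S)) => u v uv; rewrite !inE => xu.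
  apply: (connect_trans xu); apply: connect1.
  by rewrite -joinedSR // sub.
have := closed_connect cl (x := x) (y := y); rewrite !inE connect0 => <- //.
by rewrite (circleE SC xC) inE in yC.
Qed.

(* The arcs at c move inside the union of the circles adjacent to c. *)
Lemma adjacent_cover c S R x : agree_off c S R ->
  (exists C : circle S, adjacent c C /\ x \in val C) ->
  exists C : circle R, adjacent c C /\ x \in val C.
Proof.
move=> SR [C [/adjacentP cC xC]].
have RB := circle_of R x; set B := [set _ | _] in RB.
have xB : x \in B by rewrite inE.
exists (Sub B RB); split; last by rewrite SubK.
(* If [B] missed [c], it would also be a circle of [S], hence equal to [C], which meets [c]. *)
apply/adjacentP; rewrite SubK; apply: contraT => /[dup] cB.
have RS : agree_off c R S by move=> d /SR.
by rewrite -(circle_inj (valP C) (pi0_unmet RS RB cB) xC xB) cC.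
Qed.

Lemma agree_setU1 c S : agree_off c S (c |: S).
Proof. by move=> d /negPf dc; rewrite !inE dc. Qed.

Lemma agree_sym c S R : agree_off c S R -> agree_off c R S.
Proof. by move=> SR d /SR. Qed.

Lemma adjacent_union c S R (A B : circle S) (C : circle R) : agree_off c S R ->
    (forall E : circle S, adjacent c E <-> E = A \/ E = B) ->
    (forall E : circle R, adjacent c E <-> E = C) ->
  val C = val A :|: val B.
Proof.
move=> SR adjS adjR; apply/setP=> x; rewrite inE; apply/idP/orP => [xC | xAB].
  have [|E [/adjS[]-> xE]] := adjacent_cover (agree_sym SR) (x := x).
  - by exists C; split=> //; apply/adjR.
  - by left.
  - by right.
have [|E [/adjR-> //]] := adjacent_cover SR (x := x).
by case: xAB => xE; [exists A | exists B]; split=> //; apply/adjS; [left|right].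
Qed.

Lemma circle_disjoint S (A B : circle S) :
  A <> B -> [disjoint val A & val B].
Proof.
move=> neqAB; apply/pred0P=> x /=; apply/negP=> /andP[xA xB].
exact/neqAB/val_inj/(circle_inj (valP A) (valP B) xA xB).
Qed.

Lemma mem_only_adjacent S c k (C : circle S) :
  (forall E : circle S, adjacent c E <-> E = C) -> inl (c, k) \in val C.
Proof.
move=> adjC; have SE := circle_of S (inl (c, k)).
have Ek : inl (c, k) \in [set y | connect (joined S) (inl (c, k)) y].
  by rewrite inE connect0.
have /adjC <- : adjacent c (exist (fun E => E \in pi0 S) _ SE : circle S).
  by exists k.
exact: Ek.
Qed.

End Circles.

(** * Potentials of circles and their values along the left side *)

Section Height.
Variable D : link_diagram.
Local Notation H := (half_edge (crossing D)).
Local Notation opp := (@Defs.opp D).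
Implicit Types (S R : state D) (c : crossing D) (h : H) (x y : piece D).
Implicit Types (A B C M : {set piece D}) (p : H -> int).

Variable b : H -> bool.
Hypothesis b_face : forall h, b (face_step opp h) = b h.
Hypothesis b_turn : forall h, b (turn h) = ~~ b h.

Lemma color_opp h : b (opp h) = ~~ b h.
Proof. by rewrite -(b_face h) face_stepE b_turn negbK. Qed.

Lemma color_parity h : b h = b (h.1, ord0) (+) odd h.2.
Proof.
have := @turn_invariant _ _ (fun h => b h (+) odd h.2) h (h.1, ord0).
rewrite /= addbF => <- //; first by rewrite -addbA addbb addbF.
by move=> h1; rewrite b_turn odd_turn addbN addNb negbK.
Qed.

(* The value of p on the face of colour true along h. *)
Definition height p h := if b h then p h else p (turn h).

(* The circle C as a 1-cycle, with the faces of colour true on its left. *)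
Definition chain C h : int := if inl h \in C then (if b h then -1 else 1) else 0.

Local Notation potential C p := (is_potential opp (chain C) p).

Lemma chain_opp S C h : C \in pi0 S -> chain C (opp h) = - chain C h.
Proof.
by move=> SC; rewrite /chain (circle_opp h SC) color_opp; case: (_ \in C); case: (b h).
Qed.

(** Either smoothing moves [h] by an odd number of quarter turns, which reverses its colour. *)
Lemma chain_smooth S C h : C \in pi0 S -> chain C (smooth S h) = - chain C h.
Proof.
move=> SC; rewrite /chain (circle_smooth h SC).
suff -> : b (smooth S h) = ~~ b h by case: (_ \in C); case: (b h).
by rewrite smoothE; case: ifP; rewrite !b_turn ?negbK.
Qed.

(** Exchanging the ends of each arc reverses all signs, so the sum is its own negative. *)
Lemma chain_sum S C c : C \in pi0 S -> \sum_(k < 4) chain C (c, k) = 0.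
Proof.
move=> SC; pose s (k : 'I_4) := (smooth S (c, k)).2.
have sE k : smooth S (c, k) = (c, s k) by [].
have sK : involutive s by move=> k; rewrite /s -sE smoothK.
have : \sum_(k < 4) chain C (c, k) = - \sum_(k < 4) chain C (c, k); last by lia.
rewrite -sumrN (reindex_inj (inv_inj sK)); apply: eq_bigr => k _.
by rewrite -sE (chain_smooth _ SC).
Qed.

Lemma circle_potential S C : C \in pi0 S -> exists p, potential C p.
Proof.
move=> SC; apply: potential_exists.
- exact: opp_involutive.
- exact: opp_genus0.
- by move=> h; apply: chain_opp SC.
- by move=> c; apply: chain_sum SC.
Qed.

Lemma height_opp C p h : potential C p -> height p (opp h) = height p h.
Proof.
case=> p_face _ _; rewrite /height color_opp; case: (b h) => /=.
  by rewrite -face_stepE p_face.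
by rewrite -p_face face_stepE opp_involutive.
Qed.

(** Either both ends read the corner between them, or the jumps across the two half-edges cancel. *)
Lemma height_turn C p h : potential C p -> inl h \in C -> inl (turn h) \in C ->
  height p (turn h) = height p h.
Proof.
case=> _ p_turn _ Ch Cth; rewrite /height b_turn !p_turn /chain Ch Cth b_turn.
by case: (b h) => /=; lia.
Qed.

Lemma height_smooth S C p h : C \in pi0 S -> potential C p -> inl h \in C ->
  height p (smooth S h) = height p h.
Proof.
move=> SC Cp Ch; have := circle_smooth h SC; rewrite Ch.
rewrite smoothE; case: ifP => _ Csh; first exact: (height_turn Cp).
by rewrite -(height_turn Cp) ?turn4.
Qed.

Lemma height_circle S C p h h' : C \in pi0 S -> potential C p ->
  inl h \in C -> inl h' \in C -> height p h = height p h'.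
Proof.
move=> SC Cp Ch Ch'.
pose level := [pred x : piece D | (x \in C) &&
  (if x is inl h1 then height p h == height p h1 else false)].
have cl : closed (joined S) level.
  apply: (intro_closed (joined_sym S)) => -[h1|?] [h2|?] //= h12.
  rewrite !inE (circle_closed SC (x := inl h1) (y := inl h2) h12).
  case/andP=> Ch2 /eqP->; rewrite Ch2 /=.
  case/orP: h12 Ch2 => /eqP->; first by rewrite (height_opp _ Cp).
  by rewrite (circle_smooth _ SC) => Ch1; rewrite (height_smooth SC Cp).
have : connect (joined S) (inl h) (inl h').
  by rewrite (circleE SC Ch) inE in Ch'.
by move/(closed_connect cl); rewrite !inE Ch Ch' /= eqxx => /esym/eqP.
Qed.

Lemma potentialU A B M pA pB : [disjoint A & B] -> M = A :|: B ->
  potential A pA -> potential B pB -> potential M (fun h => pA h + pB h).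
Proof.
move=> AB -> [fA tA rA] [fB tB rB]; split=> h; rewrite ?fA ?fB ?rA ?rB //.
rewrite tA tB addrACA; congr (_ + _); rewrite /chain inE.
case: (boolP (inl h \in A)) => [hA|_]; last by rewrite add0r.
by rewrite (disjointFr AB hA) addr0.
Qed.

(** Selects the end from which the arc turns counterclockwise; the smoothing fixes its parity. *)
Lemma meets_smooth S c C : C \in pi0 S -> meets c C ->
  exists h, [/\ h.1 = c, odd h.2 = (c \in S), inl h \in C & inl (turn h) \in C].
Proof.
move=> SC /existsP[k Ck].
have := circle_smooth (c, k) SC; rewrite Ck smoothE /=.
case: ifP => [/eqP ek Ct | nk Ct]; first by exists (c, k).
exists (turn (turn (turn (c, k)))); rewrite turn4 !odd_turn; split=> //=.
by move: nk; case: (odd k) (c \in S) => [] [].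
Qed.

Lemma same_parity h h' : h.1 = h'.1 -> odd h.2 = odd h'.2 ->
  h' = h \/ h' = turn (turn h).
Proof.
case: h h' => c k [c' k'] /= <-;
  case: k k' => [[|[|[|[|k]]]] lk] [[|[|[|[|k']]]] lk'] //= _;
  solve [left; congr (_, _); exact: val_inj | right; congr (_, _); exact: val_inj].
Qed.

(* Around c, the potential of B takes the same value on both sides of the arc of
   A.  This value is the height of B, or one less when the arcs of A and B cut
   off the corners of colour true. *)
Lemma height_union c R R' A B M pA pB pM hA hB hM :
    A \in pi0 R -> B \in pi0 R -> M \in pi0 R' -> A != B -> M = A :|: B ->
    meets c A -> meets c B ->
    potential A pA -> potential B pB -> potential M pM ->
    inl hA \in A -> inl hB \in B -> inl hM \in M ->
  height pM hM = height pA hA + height pB hB - (b (c, ord0) == (c \in R))%:Z.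
Proof.
move=> RA RB RM neqAB MAB cA cB potA potB potM hA_A hB_B hM_M.
have AB : [disjoint A & B].
  apply/pred0P=> x /=; apply/negP=> /andP[xA xB].
  by rewrite (circle_inj RA RB xA xB) eqxx in neqAB.
have [h0 [c0 odd0 A0 A1]] := meets_smooth RA cA.
have [h [ch oddh B2 B3]] := meets_smooth RB cB.
(* Both arcs start at ends of the same parity; as [A] and [B] are disjoint, these ends are
   opposite. *)
have [||h_h0|h_h2] := @same_parity h0 h; first by rewrite c0.
- by rewrite odd0.
- by rewrite h_h0 (disjointFr AB A0) in B2.
rewrite {h}h_h2 in ch oddh B2 B3.
have M0 : inl h0 \in M by rewrite MAB inE A0.
rewrite (height_circle RA potA hA_A A0) (height_circle RB potB hB_B B2).
rewrite (height_circle RM potM hM_M M0).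
(* The arc from [h0] to [turn h0] cuts off the corner of the face [turn h0], whose colour is
   [~~ b h0]. *)
have -> : (b (c, ord0) == (c \in R)) = ~~ b h0.
  by rewrite (color_parity h0) c0 odd0; case: (b _) (_ \in _) => [] [].
have pME := potential_unique potM (potentialU AB MAB potA potB).
rewrite /height !pME !b_turn negbK.
case: potA potB => _ tA _ [_ tB _]; rewrite !tA !tB /chain !b_turn !negbK A0.
rewrite (disjointFr AB A0) (disjointFr AB A1) B2.
by case: (b h0) => /=; clear; lia.
Qed.

(* The choice of the end 0 at each crossing is arbitrary. *)
Definition twists S C : nat :=
  \sum_(c in S) (~~ b (c, ord0) && (inl (c, ord0) \in C)).

Lemma twistsU1 S c C : c \notin S ->
  twists (c |: S) C = (~~ b (c, ord0) && (inl (c, ord0) \in C) + twists S C)%N.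
Proof. by move=> cS; rewrite /twists big_setU1. Qed.

Lemma twistsU S A B : [disjoint A & B] ->
  twists S (A :|: B) = (twists S A + twists S B)%N.
Proof.
move=> AB; rewrite /twists -big_split; apply: eq_bigr => c _ /=; rewrite in_setU.
case: (boolP (_ \in A)) => [cA|_]; first by rewrite (disjointFr AB cA) andbF addn0.
by rewrite andbF.
Qed.

Lemma twists_arc S c A B C : c \notin S -> C = A :|: B ->
    [disjoint A & B] -> inl (c, ord0) \in C ->
  twists (c |: S) C = (~~ b (c, ord0) + twists S C)%N /\
  forall R, twists R C = (twists R A + twists R B)%N.
Proof.
move=> cS -> AB C0; split=> [|R]; last exact: twistsU.
by rewrite twistsU1 // C0 andbT.
Qed.

End Height.

(** * The twisting weight *)

Theorem theorem6 (D : link_diagram) :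
  exists nu : forall S : state D, circle S -> int, twisting_weight nu.
Proof.
have [b [b_face b_turn]] := checkerboard (@opp_involutive D) (opp_genus0 D).
(* The potential is chosen for the set of pieces alone, independently of the state, so that
   identified circles share it. *)
have [pot potP] : exists pot : {set piece D} -> half_edge (crossing D) -> int,
    forall C S, C \in pi0 S -> is_potential (@Defs.opp D) (chain b C) (pot C).
  apply: (fin_all_exists (P := fun C p => forall S, C \in pi0 S ->
    is_potential (@Defs.opp D) (chain b C) p)) => C.
  case: (pickP (fun S => C \in pi0 S)) => [S SC | noS].
    by have [p pP] := circle_potential b_face b_turn SC; exists p.
  by exists (fun=> 0) => S; rewrite noS.
(* Among circles, only the crossingless components take the default value 0. *)
pose q (C : {set piece D}) : int :=
  if [pick h | inl h \in C] is Some h then height b (pot C) h else 0.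
have qE c (C : {set piece D}) : meets c C ->
    exists2 h, inl h \in C & q C = height b (pot C) h.
  case/existsP=> k Ck; rewrite /q; case: pickP => [h Ch|/(_ (c, k))]; first by exists h.
  by rewrite Ck.
(* [R] is the state with two circles at [c]: [c |: S] for a splitting, [S] for a merging. *)
have qU c R R' (A B : circle R) (M : circle R') : A <> B ->
    val M = val A :|: val B -> meets c (val A) -> meets c (val B) ->
    q (val M) = q (val A) + q (val B) - (b (c, ord0) == (c \in R))%:Z.
  move=> neqAB MAB cA cB; have cM : meets c (val M).
    by case/existsP: cA => k Ak; apply/existsP; exists k; rewrite MAB inE Ak.
  have [hA A_hA ->] := qE _ _ cA; have [hB B_hB ->] := qE _ _ cB.
  have [hM M_hM ->] := qE _ _ cM.
  apply: (height_union b_face b_turn (valP A) (valP B) (valP M)) => //.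
  - by apply/eqP=> /val_inj.
  - exact: potP (valP A).
  - exact: potP (valP B).
  - exact: potP (valP M).
exists (fun S C => q (val C) + (twists b S (val C))%:Z) => S c cS; split.
- move=> C C1 C2 [adjC neq12 adj12].
  have CE := adjacent_union (agree_sym (@agree_setU1 D c S)) adj12 adjC.
  have c1 : meets c (val C1) by apply/adjacentP/adj12; left.
  have c2 : meets c (val C2) by apply/adjacentP/adj12; right.
  have := qU c _ _ C1 C2 C neq12 CE c1 c2; rewrite setU11 => ->.
  have C0 := mem_only_adjacent ord0 adjC.
  (* With [c] in the two-circle state, e is 1 exactly when [b (c, ord0)] holds; otherwise the twist
     supplies the missing 1. *)
  have [+ tU] := twists_arc b cS CE (circle_disjoint neq12) C0.
  rewrite {1}tU; move: (q _) (q _) (twists _ _ _) (twists _ _ _) (twists _ _ _).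
  by case: (b _) => /=; clear; lia.
- move=> C1 C2 C [neq12 adj12 adjC].
  have CE := adjacent_union (@agree_setU1 D c S) adj12 adjC.
  have c1 : meets c (val C1) by apply/adjacentP/adj12; left.
  have c2 : meets c (val C2) by apply/adjacentP/adj12; right.
  have := qU c _ _ C1 C2 C neq12 CE c1 c2; rewrite (negPf cS) => ->.
  have C0 := mem_only_adjacent ord0 adjC.
  (* Here e is 1 exactly when [b (c, ord0)] fails, and the new twist on the merged circle cancels
     it. *)
  have [-> ->] := twists_arc b cS CE (circle_disjoint neq12) C0.
  move: (q _) (q _) (twists _ _ _) (twists _ _ _).
  by case: (b _) => /=; clear; lia.
move=> C C' [cC CC'].
have C0 : inl (c, ord0) \notin val C by apply/negP=> C0; apply: cC; exists ord0.
suff tw K : val C = K ->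
    q (val C) + (twists b S (val C))%:Z = q K + (twists b (c |: S) K)%:Z.
  exact: tw.
by move=> <-; rewrite twistsU1 // (negPf C0) andbF.
Qed.
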